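(* Every primary $G$-top module is a $G$-top module.
   Context: $G$ is a multiplicative group, $R=\bigoplus_{g\in G}R_g$ is a commutative $G$-graded ring with identity ($R_gR_h\subseteq R_{gh}$), and $M=\bigoplus_{g\in G}M_g$ is a $G$-graded $R$-module ($R_gM_h\subseteq M_{gh}$). $h(R)=\bigcup_g R_g$ and $h(M)=\bigcup_g M_g$ are the sets of homogeneous elements. An ideal $I$ is graded if $I=\bigoplus_g(I\cap R_g)$; a submodule $N$ is graded if $N=\bigoplus_g(N\cap M_g)$. For a graded submodule $N$, $(N:_R M)=\{r\in R: rM\subseteq N\}$. For a graded ideal $I$, the graded radical $Gr(I)$ is the set of all $a=\sum_g a_g\in R$ such that for each $g$ there is $n_g>0$ with $a_g^{n_g}\in I$. A proper graded submodule $P$ of $M$ is graded prime if for $r\in h(R)$, $m\in h(M)$, $rm\in P$ implies $m\in P$ or $r\in(P:_R M)$. $Spec_G(M)$ is the set of graded prime submodules of $M$. A proper graded submodule $Q$ is graded primary if for $r\in h(R)$, $m\in h(M)$, $rm\in Q$ implies $m\in Q$ or $r\in Gr((Q:_R M))$. For a graded submodule $N$, $Gr_M(N)$ is the intersection of all graded prime submodules of $M$ containing $N$, with $Gr_M(N)=M$ if there are none. The graded primary spectrum $\mathcal{PS}_G(M)$ is the set of all graded primary submodules $Q$ of $M$ with $(Gr_M(Q):_R M)=Gr((Q:_R M))$. For a graded submodule $N$ of $M$, $\nu^*_G(N)=\{Q\in\mathcal{PS}_G(M): N\subseteq Gr_M(Q)\}$ and $V^*_G(N)=\{P\in Spec_G(M):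 N\subseteq P\}$. $M$ is a $G$-top module if the collection $\zeta^*(M)=\{V^*_G(N): N \text{ a graded submodule of } M\}$ is closed under finite union. $M$ is a primary $G$-top module if the collection $\Omega^*(M)=\{\nu^*_G(N): N\text{ a graded submodule of }M\}$ is closed under finite union. Standing assumption: $Spec_G(M)$ and $\mathcal{PS}_G(M)$ are non-empty. *)

(* Defs.v *)
From mathcomp Require Import all_boot all_algebra.
From mathcomp Require Import boolp classical_sets functions cardinality fsbigop.
From mathcomp Require Import measurable_structure.

Set Implicit Arguments.
Unset Strict Implicit.
Unset Printing Implicit Defensive.

Import GRing.Theory.

Local Open Scope classical_set_scope.
Local Open Scope ring_scope.

Section DirectSum.
Variables (G : groupType) (V : zmodType).
Implicit Types (N : set V) (F : G -> set V) (c : G -> V) (x : V).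

Definition decomposition F c x :=
  [/\ forall g, F g (c g),
      finite_set [set g | c g != 0]
    & x = \sum_(g \in [set: G]) c g].

Definition direct_sum N F :=
  [/\ forall g, zmod_closed [in F g],
      forall c x, decomposition F c x -> N x
    & forall x, N x -> exists! c, decomposition F c x].

Definition homogeneous F : set V := \bigcup_g F g.

End DirectSum.

Section GradedModules.
Variables (G : groupType) (R : comPzRingType) (M : lmodType R).
Variables (Rg : G -> set R) (Mg : G -> set M).
Implicit Types (I : set R) (N P Q : set M).

Definition graded_ring :=
  direct_sum [set: R] Rg /\
  forall g h r s, Rg g r -> Rg h s -> Rg (g * h)%g (r * s).

Definition graded_module :=
  direct_sum [set: M] Mg /\
  forall g h r m, Rg g r -> Mg h m -> Mg (g * h)%g (r *: m).

Definition graded_submodule N :=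
  submod_closed [in N] /\ direct_sum N (fun g => N `&` Mg g).

Definition residual N : set R := [set r | forall m, N (r *: m)].

Definition graded_radical I : set R :=
  [set a | exists2 c, decomposition Rg c a
         & forall g, exists2 n, (0 < n)%N & I (c g ^+ n)].

Definition graded_prime P :=
  [/\ graded_submodule P,
      P <> [set: M]
    & forall r m, homogeneous Rg r -> homogeneous Mg m ->
        P (r *: m) -> P m \/ residual P r].

Definition graded_primary Q :=
  [/\ graded_submodule Q,
      Q <> [set: M]
    & forall r m, homogeneous Rg r -> homogeneous Mg m ->
        Q (r *: m) -> Q m \/ graded_radical (residual Q) r].

Definition graded_spectrum : set (set M) := [set P | graded_prime P].

Definition prime_variety N : set (set M) :=
  [set P | graded_spectrum P /\ N `<=` P].

(* The empty intersection is [set: M]. *)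
Definition submodule_radical N : set M := \bigcap_(P in prime_variety N) P.

Definition primary_spectrum : set (set M) :=
  [set Q | graded_primary Q /\
    residual (submodule_radical Q) = graded_radical (residual Q)].

Definition primary_variety N : set (set M) :=
  [set Q | primary_spectrum Q /\ N `<=` submodule_radical Q].

Definition G_top_module :=
  fin_bigcup_closed [set prime_variety N | N in graded_submodule].

Definition primary_G_top_module :=
  fin_bigcup_closed [set primary_variety N | N in graded_submodule].

End GradedModules.

(* Main.v *)
Require Import Defs.
From mathcomp Require Import all_boot all_algebra.
From mathcomp Require Import boolp classical_sets.
From mathcomp Require Import functions cardinality fsbigop measurable_structure.

(** A graded prime submodule [P] belongs to the graded primary spectrum and is
its own graded radical, because [(P : M)] is a graded ideal equal to its graded
radical.  Hence the variety of [N] is the trace on the graded spectrum of the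
primary variety of [N], and taking traces commutes with finite unions. *)

Set Implicit Arguments.
Unset Strict Implicit.
Unset Printing Implicit Defensive.

Import GRing.Theory.

Local Open Scope classical_set_scope.

Section FiniteSums.
Local Open Scope ring_scope.
Variables (I : choiceType) (V : zmodType).

Lemma fsum_closed (N : set V) (c : I -> V) :
  N 0 -> (forall x y, N x -> N y -> N (x + y)) -> (forall i, N (c i)) ->
  N (\sum_(i \in [set: I]) c i).
Proof. by move=> N0 ND Nc; apply: big_ind. Qed.

Lemma fsum_scaler (R : pzRingType) (M : lmodType R) (c : I -> R) (m : M) :
  finite_set [set i | c i != 0] ->
  (\sum_(i \in [set: I]) c i) *: m = \sum_(i \in [set: I]) c i *: m.
Proof.
move=> fin_c.
have c0 i : ~ [set j | c j != 0] i -> c i = 0.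
  by move=> /negP; rewrite negbK => /eqP.
(* Both sums are cut down to the support of [c], because the support of [c i *: m] may be strictly
   smaller. *)
rewrite -(fsbig_widen [set i | c i != 0] setT c) //; last by move=> i [_ /c0].
rewrite -(fsbig_widen [set i | c i != 0] setT (fun i => c i *: m)) //; last first.
  by move=> i [_ /c0 /= ->]; rewrite scale0r.
by rewrite !fsbig_finite// scaler_suml.
Qed.

End FiniteSums.

Section GradedPrimes.
Local Open Scope ring_scope.
Variables (G : groupType) (R : comPzRingType) (M : lmodType R).
Variables (Rg : G -> set R) (Mg : G -> set M).
Hypotheses (gradedR : graded_ring Rg) (gradedM : graded_module Rg Mg).
Implicit Types (P N : set M).

Lemma homogeneous_span (N : set M) :
  N 0 -> (forall x y, N x -> N y -> N (x + y)) ->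
  (forall m, homogeneous Mg m -> N m) -> forall m, N m.
Proof.
move=> N0 ND Nh m; have [[_ _ /(_ m I)[c [[Mc _ ->] _]]] _] := gradedM.
by apply: fsum_closed => // g; apply: Nh; exists g.
Qed.

Lemma homogeneousZ r m :
  homogeneous Rg r -> homogeneous Mg m -> homogeneous Mg (r *: m).
Proof.
move=> [g _ Rr] [h _ Mm]; have [_ RM] := gradedM.
by exists (g * h)%g => //; exact: RM.
Qed.

(** Right translation by [h] is a bijection of [G], so multiplying by [m] only shifts degrees: no
    two components of [a] land in the same degree. *)
Lemma decompositionZ {c a h m} :
  decomposition Rg c a -> Mg h m ->
  decomposition Mg (fun k => c (k * h^-1)%g *: m) (a *: m).
Proof.
move=> [Rc fin_c ->] Mm; have [_ RM] := gradedM; split.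
- by move=> k; have := RM _ _ _ _ (Rc (k * h^-1)%g) Mm; rewrite mulgVK.
- apply: sub_finite_set (finite_image (fun g => g * h)%g fin_c) => k /= ck.
  exists (k * h^-1)%g; last by rewrite mulgVK.
  by apply: contra ck => /eqP ->; rewrite scale0r.
- rewrite fsum_scaler// [RHS](reindex_fsbigT (fun g => g * h)%g); last first.
    by exists (fun g => g * h^-1)%g => g; rewrite ?mulgK ?mulgVK.
  by apply: eq_fsbigr => g _; rewrite mulgK.
Qed.

Section Submodule.
Variable P : set M.
Hypothesis gradedP : graded_submodule Mg P.

Lemma submodule0 : P 0.
Proof. by case: gradedP => -[+ _] _; rewrite in_setE. Qed.

Lemma submoduleDZ r x y : P x -> P y -> P (r *: x + y).
Proof.
case: gradedP => -[_ +] _ => /(_ r x y); rewrite !in_setE; exact.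
Qed.

Lemma submoduleD x y : P x -> P y -> P (x + y).
Proof. by move=> Px Py; rewrite -[x]scale1r; exact: submoduleDZ. Qed.

Lemma submoduleZ r x : P x -> P (r *: x).
Proof. by move=> Px; rewrite -[r *: x]addr0; apply: submoduleDZ submodule0. Qed.

(** The decomposition of [x] inside [P] is also one inside the whole module, where decompositions
    are unique. *)
Lemma component_in {c x} g : decomposition Mg c x -> P x -> P (c g).
Proof.
move=> dc Px; have [_ [_ _ /(_ x Px)[d [[Pd fin_d dE] _]]]] := gradedP.
have [[_ _ /(_ x I)[e [_ uniq_e]]] _] := gradedM.
have <- : d = c.
  by rewrite -(uniq_e _ dc); apply/esym/uniq_e; split=> // h; have [] := Pd h.
by have [] := Pd g.
Qed.

Lemma residual_homogeneous r :
  (forall m, homogeneous Mg m -> P (r *: m)) -> residual P r.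
Proof.
apply: homogeneous_span => [|x y]; first by rewrite scaler0; exact: submodule0.
by rewrite scalerDr; exact: submoduleD.
Qed.

(** This makes the residual a graded ideal. For [m] of degree [h], [c g *: m] is the component of
    [a *: m] in degree [g * h], and [P] contains the components of its elements. *)
Lemma residual_component c a g :
  decomposition Rg c a -> residual P a -> residual P (c g).
Proof.
move=> dc Pa; apply: residual_homogeneous => m [h _ Mm].
by have := component_in (g * h)%g (decompositionZ dc Mm) (Pa m); rewrite mulgK.
Qed.

Lemma residual_fsum (c : G -> R) :
  (forall g, residual P (c g)) -> residual P (\sum_(g \in [set: G]) c g).
Proof.
apply: fsum_closed => [m|x y Px Py m]; first by rewrite scale0r; exact: submodule0.
by rewrite scalerDl; exact: submoduleD.
Qed.

End Submodule.

(** Factors [r] are peeled off one at a time: [r ^+ n *: m] stays homogeneous, so primeness applies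
    to [r *: (r ^+ n *: m)]. After the last factor [m] itself lies in [P], hence so does
    [r *: m]. *)
Lemma graded_primeX P r n :
  graded_prime Rg Mg P -> homogeneous Rg r ->
  residual P (r ^+ n) -> residual P r.
Proof.
move=> [gradedP _ primeP] Rr Prn; apply: (residual_homogeneous gradedP) => m Mm.
have hX k : homogeneous Mg (r ^+ k *: m).
  by elim: k => [|k IH]; rewrite ?expr0 ?scale1r// exprS -scalerA; exact: homogeneousZ.
elim: n {Prn}(Prn m) => [|n IH]; first by rewrite expr0 scale1r; exact: submoduleZ.
by rewrite exprS -scalerA => /(primeP _ _ Rr (hX n))[/IH|]//; exact.
Qed.

Lemma graded_radical_prime P :
  graded_prime Rg Mg P -> graded_radical Rg (residual P) = residual P.
Proof.
move=> primeP; have [gradedP _ _] := primeP; apply/seteqP; split=> a.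
  move=> [c [Rc _ ->] Pc]; apply: (residual_fsum gradedP) => g.
  have [n _ Pn] := Pc g; apply: graded_primeX Pn => //.
  by exists g.
have [[_ _ /(_ a I)[c [dc _]]] _] := gradedR => Pa; exists c => // g.
(* The exponent 1 suffices, since the components of [a] already lie in the residual. *)
by exists 1%N => //; rewrite expr1; exact: residual_component Pa.
Qed.

(** [P] is the least graded prime containing [P]. *)
Lemma submodule_radical_prime P :
  graded_prime Rg Mg P -> submodule_radical Rg Mg P = P.
Proof.
move=> primeP; apply/seteqP; split=> [m|m Pm Q [_]]; last exact.
by apply; split.
Qed.

Lemma graded_prime_primary P :
  graded_prime Rg Mg P -> primary_spectrum Rg Mg P.
Proof.
move=> primeP; have [gradedP properP mulP] := primeP.
split; last by rewrite submodule_radical_prime// graded_radical_prime.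
split=> // r m Rr Mm Prm; rewrite graded_radical_prime//; exact: mulP.
Qed.

Lemma prime_varietyE N :
  prime_variety Rg Mg N = primary_variety Rg Mg N `&` graded_spectrum Rg Mg.
Proof.
apply/seteqP; split=> P.
  move=> [primeP NP]; split=> //; split; first exact: graded_prime_primary.
  by rewrite submodule_radical_prime.
by move=> [[_ NP] primeP]; split=> //; rewrite submodule_radical_prime in NP.
Qed.

End GradedPrimes.

Theorem corollary2p7 (G : groupType) (R : comPzRingType) (M : lmodType R)
    (Rg : G -> set R) (Mg : G -> set M)
    (gradedR : graded_ring Rg) (gradedM : graded_module Rg Mg)
    (spec_neq0 : graded_spectrum Rg Mg !=set0)
    (pspec_neq0 : primary_spectrum Rg Mg !=set0) :
  primary_G_top_module Rg Mg -> G_top_module Rg Mg.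
Proof.
have VE := @prime_varietyE _ _ _ _ _ gradedR gradedM.
move=> /fin_bigcup_closedP[[N gradedN N0] topU].
apply/fin_bigcup_closedP; split.
  (* Finite unions include the empty one: if the primary variety of [N] is empty, so is its
     trace. *)
  by exists N => //; rewrite VE N0 set0I.
move=> _ _ [N1 gradedN1 <-] [N2 gradedN2 <-].
have [||K gradedK KE] := topU (primary_variety Rg Mg N1) (primary_variety Rg Mg N2).
- by exists N1.
- by exists N2.
(* The [K] obtained for the primary varieties serves unchanged, as intersection with the graded
   spectrum distributes over union. *)
by exists K => //; rewrite !VE KE setIUl.
Qed.
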